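(* Let $(e_k)_{k \ge 1}$ be a sequence of integers such that $e_1 \ge 1$ and $2^{e_k} > 10^{e_{k-1}}$ for all $k \ge 2$. Let $k \ge 1$, and suppose that $N$ is a positive integer which is divisible by $2^{e_k}$ but not by $10$. Then $c_{10}(N) \ge k$.
   Context: For an integer $b \ge 2$ and a nonnegative integer $N$, $c_b(N)$ denotes the number of nonzero digits in the base-$b$ expansion of $N$. *)

(* Defs.v *)
From mathcomp Require Import all_boot.

Set Implicit Arguments.
Unset Strict Implicit.
Unset Printing Implicit Defensive.

Definition digit (b N i : nat) : nat := (N %/ b ^ i) %% b.

(* Least significant digit first, without leading zeros, except that the
   expansion of 0 is [:: 0]. Meaningful for b >= 2 only. *)
Definition digits (b N : nat) : seq nat :=
  mkseq (digit b N) (trunc_log b N).+1.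

Definition nonzero_digits (b N : nat) : nat :=
  count (fun d => d != 0) (digits b N).

Lemma digits_lt (b N : nat) : 1 < b -> all (fun d => d < b) (digits b N).
Proof.
by move=> b1; apply/allP => _ /mapP[i _ ->]; rewrite ltn_mod (ltnW b1).
Qed.

Lemma digits_sum (b N : nat) : 1 < b ->
  \sum_(i < size (digits b N)) nth 0 (digits b N) i * b ^ i = N.
Proof.
move=> b1; rewrite size_mkseq.
under eq_bigr => i _ do rewrite nth_mkseq //.
suff sumE n : \sum_(i < n) digit b N i * b ^ i = N %% b ^ n.
  by rewrite sumE modn_small // trunc_log_ltn.
elim: n => [|n IHn]; first by rewrite big_ord0 modn1.
rewrite big_ord_recr /= IHn addnC /digit modn_divl -expnS.
by rewrite [RHS](divn_eq _ (b ^ n)) modn_dvdm // dvdn_exp2l.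
Qed.

(* Main.v *)
(* If 2 ^ e_k divides N, then the residue M of N modulo 10 ^ e_(k-1) is
   divisible by 2 ^ e_(k-1) but not by 10, so by induction the last e_(k-1)
   digits of N include k - 1 nonzero ones. Since N >= 2 ^ e_k > 10 ^ e_(k-1),
   there is at least one more nonzero digit further left. *)

Require Import Defs.
From HB Require Import structures.
From mathcomp Require Import all_boot all_order all_algebra.

Set Implicit Arguments.
Unset Strict Implicit.
Unset Printing Implicit Defensive.

Import Order.TTheory GRing.Theory Num.Theory.

(** Positions past the leading digit contribute zeros, so the range of summation can be chosen
    freely above it. *)
Lemma nonzero_digitsE (b N n : nat) : 1 < b -> N < b ^ n ->
  nonzero_digits b N = \sum_(0 <= i < n) (digit b N i != 0).
Proof.
move=> b1 ltN.
have widen m p : m <= p -> N < b ^ m ->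
    \sum_(0 <= i < p) (digit b N i != 0) = \sum_(0 <= i < m) (digit b N i != 0).
  move=> le_mp ltNm; rewrite (big_cat_nat (leq0n m) le_mp) //= [X in _ + X]big_nat_cond.
  rewrite [X in _ + X]big1 ?addn0 // => i /andP[/andP[le_mi _] _].
  rewrite /digit divn_small ?mod0n // (leq_trans ltNm) //.
  by rewrite leq_exp2l.
have -> : nonzero_digits b N =
    \sum_(0 <= i < (trunc_log b N).+1) (digit b N i != 0).
  by rewrite /nonzero_digits /digits /mkseq count_map -sum1_count big_mkcond.
have [le|/ltnW le] := leqP (trunc_log b N).+1 n.
  by rewrite [RHS](widen _ _ le) // trunc_log_ltn.
by rewrite (widen _ _ le).
Qed.

Lemma nonzero_digits_divmod (b N m : nat) : 1 < b ->
  nonzero_digits b N =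
    nonzero_digits b (N %% b ^ m) + nonzero_digits b (N %/ b ^ m).
Proof.
move=> b1; have b0 := ltnW b1; have ltN := ltn_expl N b1.
(* Since [N < b ^ N], [N] positions suffice for the quotient; with the [m] low ones they make
   [m + N]. *)
rewrite (@nonzero_digitsE b N (m + N)) //; last first.
  by rewrite (leq_trans ltN) // leq_exp2l // leq_addl.
rewrite (@nonzero_digitsE b (N %% _) m) ?ltn_mod ?expn_gt0 ?b0 //.
rewrite (@nonzero_digitsE b (N %/ _) N) ?(leq_ltn_trans (leq_div _ _)) //.
rewrite (big_cat_nat (leq0n m) (leq_addr N m)) //=; congr (_ + _).
  apply: eq_big_nat => i /andP[_ lt_im].
  by rewrite /digit !modn_divl -expnS modn_dvdm // dvdn_exp2l.
rewrite -{1}[m]add0n big_addn addKn; apply: eq_big_nat => i _.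
by rewrite /digit -divnMA -expnD [i + m]addnC.
Qed.

Lemma nonzero_digits_gt0 (b N : nat) : 1 < b -> 0 < N ->
  0 < nonzero_digits b N.
Proof.
move=> b1; rewrite -has_count; apply: contraLR => /hasPn all0.
rewrite -leqNgt leqn0 -(digits_sum N b1) big1 // => i _.
by have /all0/negPn/eqP -> := mem_nth 0 (ltn_ord i).
Qed.

Lemma leq_nonzero_digits (f : nat -> nat) :
    (forall k, 0 < k -> 0 < f k) ->
    (forall k, 0 < k -> 10 ^ f k < 2 ^ f k.+1) ->
  forall k N, 0 < k -> 2 ^ f k %| N -> ~~ (10 %| N) -> k <= nonzero_digits 10 N.
Proof.
move=> f_gt0 f_lt; elim=> // k IHk N _ dvd_N ndvd_N.
have N_gt0 : 0 < N by rewrite lt0n; apply: contraNneq ndvd_N => ->.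
(* One nonzero digit needs only [0 < N]; [f 0] is unconstrained, so the splitting starts at
   [0 < k]. *)
have [->|k_gt0] := posnP k; first exact: nonzero_digits_gt0.
have lt_pow := f_lt k k_gt0.
have le_f : f k <= f k.+1.
  by rewrite -(@leq_exp2l 2) // ltnW // (leq_ltn_trans _ lt_pow) // leq_exp2r ?f_gt0.
rewrite (@nonzero_digits_divmod 10 N (f k)) // -addn1 leq_add //.
  apply: IHk => //.
    (* Reduction modulo [10 ^ f k] preserves divisibility by its divisor [2 ^ f k]. *)
    rewrite /dvdn modn_dvdm; last by rewrite (@expnMn 2 5) dvdn_mulr.
    exact: dvdn_trans (dvdn_exp2l 2 le_f) dvd_N.
  (* As [0 < f k], the residue keeps the last digit of [N]. *)
  by rewrite /dvdn modn_dvdm // -[X in X %| _]expn1 dvdn_exp2l ?f_gt0.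
apply: nonzero_digits_gt0 => //; rewrite divn_gt0 ?expn_gt0 //.
by rewrite ltnW // (leq_trans lt_pow) // dvdn_leq.
Qed.

(* The powers in he are integer powers of rationals. The hypotheses force
   e k > 0 for k >= 1, so the absolute value in hdvd is e k itself. *)
Theorem theorem3p1 (e : nat -> int)
    (he1 : (1 <= e 1%N)%R)
    (he : forall k : nat, 2 <= k -> ((10 : rat) ^ e k.-1 < (2 : rat) ^ e k)%R)
    (k : nat) (hk : 1 <= k)
    (N : nat) (hN : 0 < N)
    (hdvd : 2 ^ `|e k| %| N) (hndvd : ~~ (10 %| N)) :
  k <= nonzero_digits 10 N.
Proof.
have e_gt0 n : 0 < n -> (0 < e n)%R.
  elim: n => // -[_ _|n IHn _]; first by rewrite (lt_le_trans _ he1).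
  have := he n.+2 isT; rewrite /= ltNge; apply: contraNT; rewrite -leNgt.
  (* A nonpositive [e n.+2] would give a power of 2 at most 1, hence at most [10 ^ p], against
     [he]. *)
  case: (e n.+1) (IHn isT) => // p _; case: (e n.+2) => [[|q]|q] // _.
    by rewrite expr0z exprn_ege1.
  rewrite NegzE -exprnN; apply: (@le_trans _ _ 1%R); last exact: exprn_ege1.
  by rewrite invf_le1 ?exprn_ege1 ?exprn_gt0.
apply: (@leq_nonzero_digits (fun n => `|e n|%N)) => // n n_gt0.
  by rewrite absz_gt0 gt_eqF ?e_gt0.
have := he n.+1 n_gt0; rewrite /=.
(* With positive exponents, both rational powers are casts of natural ones. *)
rewrite -[e n]gtz0_abs ?e_gt0 // -[e n.+1]gtz0_abs ?e_gt0 //.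
by rewrite !absz_nat -!exprnP -!natrX ltr_nat.
Qed.
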